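(* Let $I$ be a non-empty set and let $E\subseteq\mathbb{R}^I$ be a linear subspace containing all $e_i$ ($i\in I$), endowed with a complete absolute normalised norm $\|\cdot\|_E$ such that $\operatorname{span}\{e_i:i\in I\}$ is dense in $E$. If $(X_i)_{i\in I}$ is a family of $\mathrm{luacs}^+$ Banach spaces and $E$ is $\mathrm{luacs}^+$ and has the property $(P)$, then $\bigl[\bigoplus_{i\in I}X_i\bigr]_E$ is also a $\mathrm{luacs}^+$ space.
   Context: Banach spaces are real; $S_X$ denotes the unit sphere of $X$ and $X^*$ its dual. A Banach space $X$ is called $\mathrm{luacs}^+$ if for every $x\in S_X$, every sequence $(x_n)$ in $S_X$ with $\|x_n+x\|\to 2$ and all $x^*\in S_{X^*}$: $x^*(x_n)\to 1\iff x^*(x)=1$. For a non-empty set $I$, $e_i\in\mathbb{R}^I$ denotes the characteristic function of $\{i\}$. A norm $\|\cdot\|_E$ on a subspace $E$ of $\mathbb{R}^I$ (with all $e_i\in E$) is absolute if whenever $(a_i)_{i\in I}\in E$, $(b_i)_{i\in I}\in\mathbb{R}^I$ and $|a_i|=|b_i|$ for all $i\in I$, then $(b_i)_{i\in I}\in E$ and $\|(a_i)_{i\in I}\|_E=\|(b_i)_{i\in I}\|_E$; it is normalised if $\|e_i\|_E=1$ for every $i\in I$. $E$ has the property $(P)$ if for every sequence $(a_n)$ in $S_E$ and every $a\in S_E$, $\|a_n+a\|_E\to 2$ implies $a_n\to a$ pointwise on $I$. For a family $(X_i)_{i\in I}$ of Banach spaces, the absolute sum with respect to $E$ is $\bigl[\bigoplus_{i\in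 I}X_i\bigr]_E=\{(x_i)_{i\in I}\in\prod_{i\in I}X_i:(\|x_i\|)_{i\in I}\in E\}$ with the norm $\|(x_i)_{i\in I}\|_E=\|(\|x_i\|)_{i\in I}\|_E$; it is a Banach space. *)

(* Defs.v *)
From HB Require Import structures.
From mathcomp Require Import all_boot all_order all_algebra.
From mathcomp Require Import all_classical all_reals all_analysis.
From mathcomp Require Import lra.

Set Implicit Arguments.
Unset Strict Implicit.
Unset Printing Implicit Defensive.

Import Order.TTheory GRing.Theory Num.Theory.
Import numFieldNormedType.Exports.

Local Open Scope classical_set_scope.
Local Open Scope ring_scope.

Definition unit_sphere (R : realType) (X : normedModType R) : set X :=
  [set x | `|x| = 1].

Definition dual_norm (R : realType) (X : normedModType R)
    (f : {linear X -> R}) : R :=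
  sup [set `|f x| | x in [set x : X | `|x| <= 1]].

(* Continuity is required separately: [sup] is 0 on unbounded sets, so that
   [dual_norm] is only meaningful for bounded functionals. *)
Definition dual_unit_sphere (R : realType) (X : normedModType R) :
    set {linear X -> R} :=
  [set f : {linear X -> R} | continuous (f : X -> R) /\ dual_norm f = 1].

Definition luacs_plus (R : realType) (X : completeNormedModType R) : Prop :=
  forall (x : X) (u : nat -> X), unit_sphere x -> (forall n, unit_sphere (u n)) ->
    `|u n + x| @[n --> \oo] --> (2 : R) ->
  forall f : {linear X -> R}, dual_unit_sphere f ->
    (f (u n) @[n --> \oo] --> (1 : R)) <-> f x = 1.

(* A linear subspace [ascarrier] of R^I containing the characteristic functions
   of all singletons, with a complete absolute normalised norm. The values of
   [asnorm] outside of [ascarrier] are irrelevant. *)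
Record absSpace (R : realType) (I : Type) := AbsSpace {
  ascarrier : {pred I -> R};
  asnorm : (I -> R) -> R;
  as_submod : submod_closed ascarrier;
  as_normD : forall a b, a \in ascarrier -> b \in ascarrier ->
    asnorm (a + b) <= asnorm a + asnorm b;
  as_normZ : forall (k : R) a, a \in ascarrier ->
    asnorm (k *: a) = `|k| * asnorm a;
  as_norm0_eq0 : forall a, a \in ascarrier -> asnorm a = 0 -> a = 0;
  as_complete : forall u : nat -> I -> R, (forall n, u n \in ascarrier) ->
    (forall e : R, 0 < e -> exists N, forall m n, (N <= m)%N -> (N <= n)%N ->
      asnorm (u m - u n) < e) ->
    exists2 a, a \in ascarrier & asnorm (u n - a) @[n --> \oo] --> (0 : R);
  as_unit : forall i, \1_[set i] \in ascarrier;
  as_absolute : forall a b : I -> R, a \in ascarrier ->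
    (forall i, `|a i| = `|b i|) -> b \in ascarrier /\ asnorm a = asnorm b;
  as_normalised : forall i, asnorm \1_[set i] = 1 }.

Section seq_complete.
Variables (R : realType) (V : normedModType R).

Lemma seq_complete_cauchy_cvg :
  (forall u : nat -> V,
    (forall e : R, 0 < e -> exists N, forall m n, (N <= m)%N -> (N <= n)%N ->
      `|u m - u n| < e) ->
    exists l, `|u n - l| @[n --> \oo] --> (0 : R)) ->
  forall F : set_system V, ProperFilter F -> cauchy F -> cvg F.
Proof.
move=> H F FF /cauchyP Fc.
have /choice[u Hu] : forall n : nat, exists x, F (ball x (n.+1%:R^-1 : R)).
  by move=> n; apply: Fc; rewrite invr_gt0 ltr0n.
have inv_small (e : R) : 0 < e ->
    exists N, forall n, (N <= n)%N -> n.+1%:R^-1 < e.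
  move=> e0; exists (Num.truncn e^-1) => n Nn.
  rewrite invf_plt ?posrE ?ltr0n//.
  apply: (lt_le_trans (truncnS_gt _)).
  by rewrite ler_nat ltnS.
have [|l Hl] := H u.
  move=> e e0; have [N HN] := inv_small (e / 2) ltac:(by rewrite divr_gt0).
  exists N => m n Nm Nn.
  have [z [zm zn]] := filter_ex (filterI (Hu m) (Hu n)).
  rewrite -ball_normE /= in zm; rewrite -ball_normE /= in zn.
  rewrite -(subrKA z) (le_lt_trans (ler_normD _ _))// (splitr e).
  rewrite ltrD// ?(lt_trans zm) ?HN//.
  by rewrite distrC (lt_trans zn) ?HN.
apply/cvg_ex; exists l; apply/cvgrPdist_lt => e e0.
have [N HN] := inv_small (e / 2) ltac:(by rewrite divr_gt0).
move/cvgrPdist_lt : Hl => /(_ (e / 2) ltac:(by rewrite divr_gt0))[M _ HM].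
have {}HM := HM (maxn N M) (leq_maxr _ _).
rewrite /= sub0r normrN normr_id in HM.
apply: filterS (Hu (maxn N M)) => z; rewrite -ball_normE /= => zu.
rewrite -(subrKA (u (maxn N M))) (le_lt_trans (ler_normD _ _))// (splitr e).
by rewrite ltrD// ?(lt_trans zu) ?HN ?leq_maxl// distrC.
Qed.

End seq_complete.

Section absSpaceType.
Variables (R : realType) (I : Type) (E : absSpace R I).

HB.instance Definition _ :=
  GRing.isSubmodClosed.Build R (I -> R) (ascarrier E) (as_submod E).

Record asType := AsElt { asval :> I -> R; asvalP : asval \in ascarrier E }.

HB.instance Definition _ := [isSub for asval].
HB.instance Definition _ := [Choice of asType by <:].
HB.instance Definition _ := [SubChoice_isSubLmodule of asType by <:].

Let nrm (a : asType) := asnorm E a.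

Let nrmD a b : nrm (a + b) <= nrm a + nrm b.
Proof. by apply: as_normD; apply: asvalP. Qed.

Let nrmZ (k : R) a : nrm (k *: a) = `|k| * nrm a.
Proof. by apply: as_normZ; apply: asvalP. Qed.

Let nrm0_eq0 a : nrm a = 0 -> a = 0.
Proof. by move=> a0; apply/val_inj/(as_norm0_eq0 _ a0)/asvalP. Qed.

HB.instance Definition _ :=
  Lmodule_isNormed.Build R asType nrmD nrmZ nrm0_eq0.

Let as_cauchy_cvg (F : set_system asType) : ProperFilter F -> cauchy F -> cvg F.
Proof.
apply: seq_complete_cauchy_cvg => u uc.
have [a aE ua] := as_complete (fun n => asvalP (u n)) uc.
by exists (AsElt aE).
Qed.

HB.instance Definition _ := Uniform_isComplete.Build asType as_cauchy_cvg.

Definition as_basis (i : I) : asType := AsElt (as_unit E i).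

End absSpaceType.

Coercion asType : absSpace >-> Sortclass.

Section absSpaceTheory.
Variables (R : realType) (I : Type) (E : absSpace R I).
Implicit Types (a b : I -> R).

Lemma as_coord_le (a : E) i : `|a i| <= `|a|.
Proof.
pose a' j := if `[< j = i >] then a j else - a j.
have [a'E a'a] : a' \in ascarrier E /\ asnorm E a = asnorm E a'.
  apply: as_absolute (asvalP a) _ => j.
  by rewrite /a'; case: asboolP => // _; rewrite normrN.
have -> : `|a i| = `|a i *: as_basis E i|.
  by rewrite normrZ -[X in _ * X]/(asnorm E \1_[set i]) as_normalised mulr1.
have -> : a i *: as_basis E i = 2^-1 *: (a + AsElt a'E).
  apply/val_inj/funext => j.
  rewrite -[LHS]/(a i * \1_[set i] j) -[RHS]/(2^-1 * (a j + a' j)) /a' indicE.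
  case: asboolP => [->|ji]; first by rewrite mem_set// mulr1; lra.
  by rewrite memNset// mulr0 subrr mulr0.
rewrite normrZ ger0_norm// (le_trans (ler_wpM2l _ (ler_normD _ _)))//.
by rewrite [X in _ + X](_ : _ = `|a|) //; lra.
Qed.

Lemma as_solid a b : b \in ascarrier E -> (forall i, `|a i| <= `|b i|) ->
  a \in ascarrier E /\ asnorm E a <= asnorm E b.
Proof.
move=> bE ab.
pose t i := if b i == 0 then 0 else a i / b i.
have t1 i : `|t i| <= 1.
  rewrite /t; case: eqVneq => [_|b0]; first by rewrite normr0.
  by rewrite normrM normfV ler_pdivrMr ?normr_gt0// mul1r.
have tb i : t i * b i = a i.
  rewrite /t; case: eqVneq => [bi|b0]; last by rewrite divfK.
  by apply/esym/eqP; rewrite mul0r -normr_le0 (le_trans (ab i))// bi normr0.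
pose sg (x : R) : R := if 0 <= x then 1 else -1.
pose v n i := iter n (fun x => 2 * x - sg x) (t i).
have v1 n i : `|v n i| <= 1.
  elim: n => [|n]; first exact: t1.
  rewrite /v iterS; move: (iter n _ _) => x.
  rewrite /sg !ler_norml => /andP[? ?].
  by case: (leP 0 x) => ?; apply/andP; split; lra.
have /choice[s Hs] : forall n, exists s : E,
    (s : I -> R) = (fun i => sg (v n i) * b i) /\ `|s| = asnorm E b.
  move=> n; have [sE sb] : (fun i => sg (v n i) * b i) \in ascarrier E /\
      asnorm E b = asnorm E (fun i => sg (v n i) * b i).
    apply: as_absolute bE _ => i; rewrite normrM /sg.
    by case: ifP => _; rewrite ?normrN normr1 mul1r.
  by exists (AsElt sE).
pose c n : E := \sum_(k < n) (2^-1 ^+ k.+1 : R) *: s k.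
have c0 : c 0%N = 0 by rewrite /c big_ord0.
have cS n : c n.+1 = c n + 2^-1 ^+ n.+1 *: s n by rewrite /c big_ord_recr.
have cE n i : a i - c n i = 2^-1 ^+ n * (v n i * b i).
  elim: n => [|n IH]; first by rewrite expr0 mul1r c0 subr0 tb.
  rewrite cS -[X in _ - X]/(c n i + 2^-1 ^+ n.+1 * s n i) opprD addrA IH.
  by rewrite (Hs n).1 /v iterS exprS; lra.
have cm n k : `|c (n + k)%N - c n| <= (2^-1 ^+ n - 2^-1 ^+ (n + k)) * asnorm E b.
  elim: k => [|k IH]; first by rewrite addn0 !subrr normr0 mul0r.
  rewrite addnS cS addrAC (le_trans (ler_normD _ _))//.
  rewrite normrZ (Hs _).2 ger0_norm ?exprn_ge0// exprS.
  by move: IH; lra.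
have b0 : 0 <= asnorm E b by rewrite -[asnorm E b]/(`|AsElt bE|).
have half0 : (2^-1 ^+ n * asnorm E b) @[n --> \oo] --> (0 : R).
  rewrite -[X in _ --> X](mul0r (asnorm E b)); apply: cvgMl.
  by apply: cvg_expr; rewrite ger0_norm// invf_lt1// ltr1n.
have cbd n k : `|c (n + k)%N - c n| <= 2^-1 ^+ n * asnorm E b.
  by rewrite (le_trans (cm n k))// ler_wpM2r// gerBl exprn_ge0.
have [|l lE cl] := @as_complete _ _ E (fun n => c n) (fun n => asvalP _).
  move=> e e0; move/cvgrPdist_lt : half0 => /(_ (e / 2)).
  rewrite divr_gt0// => /(_ isT)[N _ HN]; exists N => m n Nm Nn.
  have {}HN := HN N (leqnn N).
  rewrite /= sub0r normrN ger0_norm ?mulr_ge0 ?exprn_ge0// in HN.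
  rewrite -[X in X < _]/(`|c m - c n|) -(subrKA (c N)).
  rewrite (le_lt_trans (ler_normD _ _))// (splitr e).
  rewrite -(subnKC Nm) -(subnKC Nn) ltrD// ?(le_lt_trans (cbd _ _))//.
  by rewrite distrC (le_lt_trans (cbd _ _)).
pose L : E := AsElt lE.
have {}cl : `|c n - L| @[n --> \oo] --> (0 : R) by [].
have la : l = a.
  apply/funext => i; apply/eqP; rewrite -subr_eq0 -normr_le0.
  apply/ler_addgt0Pl => e e0; rewrite addr0.
  have e2 : 0 < e / 2 by rewrite divr_gt0.
  have /cvgrPdist_lt/(_ _ e2)[M _ HM] := half0.
  have /cvgrPdist_lt/(_ _ e2)[N _ HN] := cl.
  have {}HN := HN (maxn N M) (leq_maxl _ _).
  have {}HM := HM (maxn N M) (leq_maxr _ _).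
  set n := maxn N M in HN HM.
  rewrite /= sub0r normrN normr_id in HN.
  rewrite /= sub0r normrN ger0_norm ?mulr_ge0 ?exprn_ge0// in HM.
  rewrite -(subrKA (c n i)) (le_trans (ler_normD _ _))// (splitr e) lerD//.
    rewrite distrC (le_trans _ (ltW HN))//.
    exact: (as_coord_le (c n - L) i).
  rewrite distrC cE (le_trans _ (ltW HM))// normrM ger0_norm ?exprn_ge0//.
  rewrite ler_wpM2l ?exprn_ge0// normrM (le_trans (ler_piMl _ (v1 n i)))//.
  exact: (as_coord_le (AsElt bE) i).
rewrite -la; split=> //.
apply/ler_addgt0Pl => e e0.
move/cvgrPdist_lt : cl => /(_ e e0)[N _ /(_ N (leqnn N))] /=.
rewrite sub0r normrN normr_id => cN.
rewrite -[X in X <= _]/(`|L|) -[L](subrK (c N)).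
rewrite (le_trans (ler_normD _ _))// lerD//; first by rewrite distrC ltW.
by have := cbd 0%N N; rewrite add0n c0 subr0 expr0 mul1r.
Qed.

End absSpaceTheory.

Section absSum.
Variables (R : realType) (I : Type) (E : absSpace R I).
Variable X : I -> completeNormedModType R.

Record absSum := AbsSum {
  sumval :> forall i, X i;
  sumvalP : (fun i => `|sumval i|) \in ascarrier E }.

Lemma sumval_inj (x y : absSum) : (forall i, x i = y i) -> x = y.
Proof.
case: x y => [x xE] [y yE] /= xy.
have {}xy : x = y by exact: functional_extensionality_dep.
by subst y; congr AbsSum; exact: Prop_irrelevance.
Qed.

HB.instance Definition _ := gen_eqMixin absSum.
HB.instance Definition _ := gen_choiceMixin absSum.

Let nrm (x : absSum) : E := AsElt (sumvalP x).

Lemma sum_zeroP : (fun i => `|0 : X i|) \in ascarrier E.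
Proof.
rewrite (_ : (fun i => _) = 0) ?rpred0//.
by apply/funext => i; rewrite normr0.
Qed.

Lemma sum_oppP (x : absSum) : (fun i => `|- x i|) \in ascarrier E.
Proof.
by rewrite (_ : (fun i => _) = nrm x) ?asvalP//; apply/funext => i; rewrite normrN.
Qed.

Lemma sum_addP (x y : absSum) : (fun i => `|x i + y i|) \in ascarrier E.
Proof.
apply: (as_solid (asvalP (nrm x + nrm y)) _).1 => i.
rewrite normr_id -[X in _ <= `|X|]/(`|x i| + `|y i|) [leRHS]ger0_norm ?addr_ge0//.
exact: ler_normD.
Qed.

Lemma sum_scaleP (k : R) (x : absSum) : (fun i => `|k *: x i|) \in ascarrier E.
Proof.
rewrite (_ : (fun i => _) = `|k| *: nrm x) ?asvalP//.
by apply/funext => i; rewrite normrZ.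
Qed.

Definition sum_zero : absSum := AbsSum sum_zeroP.
Definition sum_opp (x : absSum) : absSum := AbsSum (sum_oppP x).
Definition sum_add (x y : absSum) : absSum := AbsSum (sum_addP x y).
Definition sum_scale (k : R) (x : absSum) : absSum := AbsSum (sum_scaleP k x).

Let sum_addA : associative sum_add.
Proof. by move=> x y z; apply: sumval_inj => i; exact: addrA. Qed.
Let sum_addC : commutative sum_add.
Proof. by move=> x y; apply: sumval_inj => i; exact: addrC. Qed.
Let sum_add0 : left_id sum_zero sum_add.
Proof. by move=> x; apply: sumval_inj => i; exact: add0r. Qed.
Let sum_addN : left_inverse sum_zero sum_opp sum_add.
Proof. by move=> x; apply: sumval_inj => i; exact: addNr. Qed.

HB.instance Definition _ :=
  GRing.isZmodule.Build absSum sum_addA sum_addC sum_add0 sum_addN.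

Let sum_scaleA (k l : R) (x : absSum) :
  sum_scale k (sum_scale l x) = sum_scale (k * l) x.
Proof. by apply: sumval_inj => i; exact: scalerA. Qed.
Let sum_scale1 : left_id 1 sum_scale.
Proof. by move=> x; apply: sumval_inj => i; exact: scale1r. Qed.
Let sum_scaleDr : right_distributive sum_scale +%R.
Proof. by move=> k x y; apply: sumval_inj => i; exact: scalerDr. Qed.
Let sum_scaleDl (x : absSum) : {morph sum_scale^~ x : k l / k + l}.
Proof. by move=> k l; apply: sumval_inj => i; exact: scalerDl. Qed.

HB.instance Definition _ := GRing.Zmodule_isLmodule.Build R absSum
  sum_scaleA sum_scale1 sum_scaleDr sum_scaleDl.

Definition sum_norm (x : absSum) : R := asnorm E (fun i => `|x i|).

Let sum_normD (x y : absSum) : sum_norm (x + y) <= sum_norm x + sum_norm y.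
Proof.
apply: le_trans (ler_normD (nrm x) (nrm y)).
apply: (as_solid (asvalP (nrm x + nrm y)) _).2 => i.
rewrite normr_id -[X in _ <= `|X|]/(`|x i| + `|y i|) [leRHS]ger0_norm ?addr_ge0//.
exact: ler_normD.
Qed.

Let sum_normZ (k : R) (x : absSum) : sum_norm (k *: x) = `|k| * sum_norm x.
Proof.
rewrite /sum_norm (_ : (fun i => _) = `|k| *: (nrm x : I -> R)); last first.
  by apply/funext => i; rewrite -[LHS]/(`|k *: x i|) normrZ.
by rewrite as_normZ ?normr_id ?asvalP.
Qed.

Let sum_norm0_eq0 (x : absSum) : sum_norm x = 0 -> x = 0.
Proof.
move=> x0; have /normr0_eq0 nx0 : `|nrm x| = 0 by [].
apply: sumval_inj => i; apply: normr0_eq0.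
by rewrite -[LHS]/(nrm x i) nx0.
Qed.

HB.instance Definition _ :=
  Lmodule_isNormed.Build R absSum sum_normD sum_normZ sum_norm0_eq0.

Let norm_nrm (x : absSum) : `|x| = `|nrm x|. Proof. by []. Qed.

Let nrmB (x y : absSum) : `|nrm x - nrm y| <= `|x - y|.
Proof.
apply: (as_solid (sumvalP (x - y)) _).2 => i.
by rewrite normr_id ler_dist_dist.
Qed.

Let coord_le (x : absSum) i : `|x i| <= `|x|.
Proof. by have := as_coord_le (nrm x) i; rewrite normr_id. Qed.

Let sum_cauchy_cvg (F : set_system absSum) :
  ProperFilter F -> cauchy F -> cvg F.
Proof.
apply: seq_complete_cauchy_cvg => u uc.
have coord i : exists l : X i, u n i @[n --> \oo] --> l.
  apply/cvg_ex/cauchy_cvgP/cauchyP => e e0; have [N HN] := uc _ e0.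
  exists (u N i); exists N => // n Nn; rewrite -ball_normE /=.
  exact: le_lt_trans (coord_le (u N - u n) i) (HN _ _ (leqnn N) Nn).
pose l i := projT1 (cid (coord i)).
have ul i : u n i @[n --> \oo] --> l i := projT2 (cid (coord i)).
(* a sequence in the sum whose norm sequence is Cauchy has its coordinatewise
   norm limit in E, and converges to it in E *)
have lim_nrm (w : nat -> absSum) (z : forall i, X i) :
    (forall e : R, 0 < e -> exists N, forall m n, (N <= m)%N -> (N <= n)%N ->
      `|w m - w n| < e) -> (forall i, w n i @[n --> \oo] --> z i) ->
    exists2 zE : (fun i => `|z i|) \in ascarrier E,
      `|nrm (w n) - AsElt zE| @[n --> \oo] --> (0 : R) & True.
  move=> wc wz.
  have [|a aE wa] := @as_complete _ _ E (fun n => nrm (w n)) (fun n => asvalP _).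
    move=> e /wc[N HN]; exists N => m n Nm Nn.
    exact: le_lt_trans (nrmB _ _) (HN _ _ Nm Nn).
  have az : a = (fun i => `|z i|).
    apply/funext => i; apply: (@cvg_unique _ (@Rhausdorff R) (`|w n i| @[n --> \oo])).
      apply/cvgrPdist_lt => e e0; move/cvgrPdist_lt : wa => /(_ e e0).
      apply: filterS => n /=; rewrite sub0r normrN.
      rewrite -[asnorm E _]/(`|nrm (w n) - AsElt aE|) normr_id => wn.
      rewrite distrC; apply: le_lt_trans wn.
      exact: (as_coord_le (nrm (w n) - AsElt aE) i).
    exact: cvg_norm (wz i).
  by subst a; exists aE.
have [lE _ _] := lim_nrm u l uc ul.
pose L := AbsSum lE; exists L.
apply/cvgrPdist_le => e e0.
have [N HN] := uc _ e0.
exists N => // n /= Nn; rewrite sub0r normrN normr_id.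
have [|i|zE] := lim_nrm (fun m => u n - u m) (fun i => u n i - l i).
- move=> d /uc[M HM]; exists M => p q Mp Mq.
  by rewrite opprB addrC subrKA HM.
- by apply: cvgB (ul i); exact: cvg_cst.
move=> /cvgrPdist_lt uz _.
have -> : `|u n - L| = `|AsElt zE| by [].
apply/ler_addgt0Pl => d d0; have [M _ HM] := uz d d0.
have := HM (maxn N M) (leq_maxr _ _); rewrite /= sub0r normrN normr_id.
set m := maxn N M => dm.
rewrite -[AsElt zE](subrK (nrm (u n - u m))) (le_trans (ler_normD _ _))//.
rewrite lerD//; first by rewrite distrC ltW.
by rewrite -norm_nrm ltW// HN// leq_maxl.
Qed.

HB.instance Definition _ := Uniform_isComplete.Build absSum sum_cauchy_cvg.

Lemma absSum_normE (x : absSum) : `|x| = asnorm E (fun i => `|x i|).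
Proof. by []. Qed.

End absSum.

Definition propertyP (R : realType) (I : Type) (E : absSpace R I) : Prop :=
  forall (u : nat -> E) (a : E), (forall n, unit_sphere (u n)) ->
    unit_sphere a -> `|u n + a| @[n --> \oo] --> (2 : R) ->
  forall i, u n i @[n --> \oo] --> a i.

Definition basis_span (R : realType) (I : Type) (E : absSpace R I) : set E :=
  [set a | exists (s : seq I) (c : I -> R),
    a = \sum_(i <- s) c i *: as_basis E i].

(* Main.v *)
Require Import Defs.
From HB Require Import structures.
From mathcomp Require Import all_boot all_order all_algebra.
From mathcomp Require Import all_classical all_reals all_analysis.
From mathcomp Require Import ring lra.

Set Implicit Arguments.
Unset Strict Implicit.
Unset Printing Implicit Defensive.

Import Order.TTheory GRing.Theory Num.Theory.
Import numFieldNormedType.Exports.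

Local Open Scope classical_set_scope.
Local Open Scope ring_scope.

(**
Let x and u_n be unit vectors of the absolute sum with |u_n + x| -> 2, and let
f be a functional of norm one.  Write f_i for the restriction of f to the i-th
summand (coordf f i) and |f_i| for its dual norm.

Coordinates.  The norm sequences (|u_n i|)_i and (|x i|)_i are unit vectors of E
whose sum has norm tending to 2, so property (P) gives |u_n i| -> |x i|.  Since
u_n + 3x has norm tending to 4, property (P), applied after normalisation to
(|u_n i + x i|)_i and 2 (|x i|)_i, also gives |u_n i + x i| -> 2 |x i|.
Hence the hypothesis on X_i, in a scale-invariant form, says that
|f_i| |u_n i| - f_i (u_n i) -> 0 if and only if f_i (x i) = |f_i| |x i|
(luacs_plus_homogeneous).

The modulus of f.  There is a functional g of norm at most one on E with
g b = \sum_i b_i |f_i|.  Its linearity is obtained without any infinite sum by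
writing g b = f ((b_i v_i)_i) for vectors v_i with f_i v_i = |f_i| and
|v_i| <= 2 (form_modulus).  The density of the span of the unit vectors makes f
monotone in its coordinates: if f_i (y i) <= f_i (z i) for all i then
f y <= f z (form_le).  So f z <= g (|z i|)_i, and the gap between the two sides
dominates every coordinate gap |f_i| |z i| - f_i (z i) (form_defect).

If f (u_n) -> 1, then g (|u_n i|)_i -> 1, so g (|x i|)_i = 1 because E is luacs+.
The coordinate gaps of u_n tend to 0, so those of x vanish, and by monotonicity
f x = g (|x i|)_i = 1.  If conversely f x = 1, all the coordinate gaps of x
vanish, so f_i (u_n i) -> f_i (x i) for every i.  A Fatou inequality for f
(form_fatou), applied to the vectors obtained by adding (|u_n i| v_i)_i to u_n
in order to make all coordinates nonnegative, bounds f (u_n) from below.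
*)

(** * Dual norms *)

Section dual_norm.
Variables (R : realType) (X : normedModType R).
Implicit Types f : {linear X -> R}.

Lemma linear_formZ f (k : R) x : f (k *: x) = k * f x.
Proof. exact: linearZ. Qed.

Lemma bounded_continuous f (M : R) :
  (forall x, `|f x| <= M * `|x|) -> continuous (f : X -> R).
Proof.
move=> fM; apply/linear_bounded_continuous/linear_boundedP.
near=> r => x; apply: le_trans (fM x) _; apply: ler_wpM2r; first exact: normr_ge0.
by near: r; apply: nbhs_pinfty_ge; exact: num_real.
Unshelve. all: by end_near. Qed.

Lemma dual_norm_has_sup f : continuous (f : X -> R) ->
  has_sup [set `|f x| | x in [set x : X | `|x| <= 1]].
Proof.
move=> /linear_bounded_continuous/linear_boundedP fb.
have [r [r0 fr]] : exists r : R, 0 <= r /\ forall x, `|f x| <= r * `|x|.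
  have [r [? ?]] := filter_ex (filterI (@nbhs_pinfty_ge R 0 (num_real 0)) fb).
  by exists r.
split; first by exists `|f 0|; exists 0; rewrite //= normr0.
exists r => _ [x /= x1 <-]; apply: le_trans (fr x) _.
by rewrite ler_piMr.
Qed.

Lemma le_dual_norm f : continuous (f : X -> R) ->
  forall x, `|f x| <= dual_norm f * `|x|.
Proof.
move=> fc x; have [->|x0] := eqVneq x 0.
  by rewrite linear0 !normr0 mulr0.
rewrite -ler_pdivrMr ?normr_gt0//.
apply: sup_upper_bound; first exact: dual_norm_has_sup.
exists (`|x|^-1 *: x); last by rewrite linear_formZ normrM normfV normr_id mulrC.
by rewrite /= normrZ normfV normr_id mulVf// normr_eq0.
Qed.

Lemma dual_norm_le f M : (forall x, `|f x| <= M * `|x|) -> 0 <= M ->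
  dual_norm f <= M.
Proof.
move=> fM M0; apply: ge_sup; first by exists `|f 0|; exists 0; rewrite //= normr0.
move=> _ [x /= x1 <-]; apply: le_trans (fM x) _.
by rewrite ler_piMr.
Qed.

Lemma dual_norm_ge0 f : continuous (f : X -> R) -> 0 <= dual_norm f.
Proof.
move=> fc; apply: sup_upper_bound; first exact: dual_norm_has_sup.
by exists 0; rewrite /= ?linear0 normr0.
Qed.

(** The supremum defining the dual norm need not be attained, but every
    proportion [c < 1] of it is attained exactly, after scaling. *)
Lemma dual_norm_approx f (c : R) : continuous (f : X -> R) -> 0 <= c < 1 ->
  exists w : X, `|w| <= 1 /\ f w = c * dual_norm f.
Proof.
move=> fc /andP[c0 c1].
have := dual_norm_ge0 fc; rewrite le_eqVlt => /predU1P[<-|g0].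
  by exists 0; rewrite normr0 linear0 mulr0.
have cg : c * dual_norm f < dual_norm f by rewrite gtr_pMl.
have [|_ [x x1 <-]] :=
  @sup_adherent _ _ (dual_norm f - c * dual_norm f) _ (dual_norm_has_sup fc).
  by rewrite subr_gt0.
rewrite -/(dual_norm f) opprB addrC subrK => cx.
have fx0 : f x != 0.
  by rewrite -normr_gt0; apply: le_lt_trans cx; rewrite mulr_ge0// ltW.
exists (c * dual_norm f / f x *: x); split; last by rewrite linear_formZ divfK.
rewrite normrZ (le_trans (ler_piMr _ x1))// normrM normfV ler_pdivrMr ?normr_gt0//.
by rewrite mul1r ger0_norm ?(ltW cx)// mulr_ge0// ltW.
Qed.

End dual_norm.

(** * Scale-invariant forms of luacs+ and of property (P) *)

Section normalization.
Variables (R : realType) (V : normedModType R).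

(** Reduces statements on sequences whose norms merely converge to statements on
    the unit sphere.  The error made in replacing [u n] by [`|t| *: w n] has
    norm [`| `|t| - `|u n| |], which tends to 0. *)
Lemma sphere_normalize (t : V) (u : nat -> V) : t != 0 ->
    `|u n| @[n --> \oo] --> `|t| -> `|u n + t| @[n --> \oo] --> 2 * `|t| ->
  exists w : nat -> V, [/\ forall n, unit_sphere (w n),
    forall n, u n = `|u n| *: w n &
    `|w n + `|t|^-1 *: t| @[n --> \oo] --> (2 : R)].
Proof.
move=> t0 ut utt; have T0 : 0 < `|t| by rewrite normr_gt0.
set y := `|t|^-1 *: t.
have y1 : `|y| = 1 by rewrite normrZ normfV normr_id mulVf// gt_eqF.
(* at a vanishing [u n] any unit vector would do *)
pose w n := if u n == 0 then y else `|u n|^-1 *: u n.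
have w1 n : `|w n| = 1.
  rewrite /w; case: eqP => [//|/eqP un0].
  by rewrite normrZ normfV normr_id mulVf// normr_eq0.
have uw n : u n = `|u n| *: w n.
  rewrite /w; case: eqP => [->|/eqP un0]; first by rewrite normr0 scale0r.
  by rewrite scalerA divff ?scale1r// normr_eq0.
exists w; split => //.
pose lb n : R := `|t|^-1 * (`|u n + t| - `| `|t| - `|u n| |).
apply: (@squeeze_cvgr _ _ _ _ lb (fun=> 2)); last exact: cvg_cst.
  near=> n; apply/andP; split; last first.
    by rewrite (le_trans (ler_normD _ _))// w1 y1.
  rewrite /lb mulrC ler_pdivrMr// lerBlDr.
  have -> : `|w n + y| * `|t| = `| `|t| *: (w n + y)|.
    by rewrite normrZ normr_id mulrC.
  have -> : u n + t = `|t| *: (w n + y) + (`|u n| - `|t|) *: w n.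
    rewrite scalerDr scalerBl -uw /y scalerA divff ?gt_eqF// scale1r.
    by rewrite [RHS]addrC addrA subrK.
  by rewrite (le_trans (ler_normD _ _))// lerD2l normrZ w1 mulr1 distrC.
rewrite /lb; have -> : (2 : R) = `|t|^-1 * (2 * `|t| - `| `|t| - `|t| |).
  by rewrite subrr normr0 subr0 mulrCA mulVf ?mulr1// gt_eqF.
apply: cvgMr; apply: cvgB => //; apply: cvg_norm; apply: cvgB => //.
exact: cvg_cst.
Unshelve. all: by end_near. Qed.

End normalization.

Section homogeneous.
Variable R : realType.

(** If [t] or [f] vanishes then both sides hold trivially; otherwise the luacs+
    property applies to the normalisations of [u n], [t] and [f]. *)
Lemma luacs_plus_homogeneous (X : completeNormedModType R) (t : X)
    (u : nat -> X) (f : {linear X -> R}) : luacs_plus X ->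
    `|u n| @[n --> \oo] --> `|t| -> `|u n + t| @[n --> \oo] --> 2 * `|t| ->
    continuous (f : X -> R) ->
  (dual_norm f * `|u n| - f (u n) @[n --> \oo] --> (0 : R)) <->
  f t = dual_norm f * `|t|.
Proof.
move=> hX ut utt fc; set g := dual_norm f.
have fg x : `|f x| <= g * `|x| := le_dual_norm fc x.
have [t0|t0] := eqVneq t 0.
  move: ut; rewrite t0 normr0 linear0 mulr0 => u0; split=> // _.
  have gu0 : g * `|u n| @[n --> \oo] --> (0 : R).
    by rewrite -(mulr0 g); apply: cvgMr.
  rewrite -(subrr 0); apply: cvgB => //.
  apply: (@squeeze_cvgr _ _ _ _ (fun n => - (g * `|u n|)) (fun n => g * `|u n|)) => //.
    by apply: nearW => n; rewrite -ler_norml.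
  by rewrite -oppr0; apply: cvgN.
have [g0|g0] := eqVneq g 0.
  have f0 x : f x = 0 by apply/eqP; rewrite -normr_le0 (le_trans (fg x))// g0 mul0r.
  split=> _; first by rewrite f0 g0 mul0r.
  rewrite (_ : (fun n => _) = fun=> 0); first exact: cvg_cst.
  by apply/funext => n; rewrite f0 g0 mul0r subrr.
have gpos : 0 < g by rewrite lt_def g0 dual_norm_ge0.
have [w [w1 uw wy]] := sphere_normalize t0 ut utt.
have T0 : `|t| != 0 by rewrite normr_eq0.
set y := `|t|^-1 *: t in wy.
have y1 : unit_sphere y by rewrite /unit_sphere /= normrZ normfV normr_id mulVf.
pose h : {linear X -> R} := g^-1 \*: f.
have hE x : h x = g^-1 * f x by [].
have h1 x : `|h x| <= 1 * `|x|.
  by rewrite hE normrM normfV (gtr0_norm gpos) mul1r ler_pdivrMl.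
have hd : dual_unit_sphere h.
  split; first exact: bounded_continuous h1.
  apply/eqP; rewrite eq_le dual_norm_le//=.
  have hc := bounded_continuous h1.
  rewrite -(ler_pM2l gpos) mulr1; apply: dual_norm_le; last first.
    by apply: mulr_ge0; [exact: ltW|exact: dual_norm_ge0].
  move=> x; rewrite -mulrA; have := le_dual_norm hc x.
  by rewrite hE normrM normfV (gtr0_norm gpos) ler_pdivrMl.
have [hX1 hX2] := hX y w y1 w1 wy h hd.
have fuE n : g * `|u n| - f (u n) = `|u n| * (g * (1 - h (w n))).
  by rewrite [in f _]uw linear_formZ hE mulrBr mulr1 mulVKf// mulrBr mulrC.
split=> [H|H].
  suff /hX1 : h (w n) @[n --> \oo] --> (1 : R).
    rewrite hE linear_formZ => fy.
    have -> : f t = g * `|t| * (g^-1 * (`|t|^-1 * f t)) by field; apply/andP.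
    by rewrite fy mulr1.
  have H1 : 1 - (g * `|u n| - f (u n)) * (g^-1 * `|u n|^-1) @[n --> \oo] --> (1 : R).
    rewrite -[X in _ --> X](subr0 1) -[X in _ - X](mul0r (g^-1 * `|t|^-1)).
    apply: cvgB; first exact: cvg_cst.
    by apply: cvgM => //; apply: cvgMr; apply: cvgV.
  apply: cvg_trans H1; apply: near_eq_cvg.
  have /cvgr_neq0 -/(_ T0) := ut; apply: filterS => n un0.
  by rewrite fuE; field; apply/andP.
have /hX2 H1 : h y = 1.
  by rewrite hE linear_formZ H; field; apply/andP.
rewrite (_ : (fun n => _) = (fun n => `|u n| * (g * (1 - h (w n))))); last first.
  exact/funext.
have -> : (0 : R) = `|t| * (g * (1 - 1)) by rewrite subrr !mulr0.
by apply: cvgM => //; apply: cvgMr; apply: cvgB => //; exact: cvg_cst.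
Qed.

Lemma propertyP_homogeneous (I : Type) (E : absSpace R I) (a : E)
    (u : nat -> E) : propertyP E ->
    `|u n| @[n --> \oo] --> `|a| -> `|u n + a| @[n --> \oo] --> 2 * `|a| ->
  a != 0 -> forall i, u n i @[n --> \oo] --> a i.
Proof.
move=> hP ua uaa a0 i; have [w [w1 uw wy]] := sphere_normalize a0 ua uaa.
have A0 : `|a| != 0 by rewrite normr_eq0.
have y1 : unit_sphere (`|a|^-1 *: a).
  by rewrite /unit_sphere /= normrZ normfV normr_id mulVf.
have wi := hP _ _ w1 y1 wy i.
rewrite (_ : (fun n => _) = (fun n => `|u n| * w n i)); last first.
  by apply/funext => n; rewrite [in LHS]uw.
have -> : a i = `|a| * (`|a|^-1 *: a) i.
  by rewrite -[X in _ * X]/(`|a|^-1 * a i) mulVKf.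
exact: cvgM.
Qed.

End homogeneous.

(** * Embedding of the summands and truncation *)

Section absSum_tools.
Variables (R : realType) (I : Type) (E : absSpace R I).
Variable X : I -> completeNormedModType R.
Local Notation S := (absSum E X).
Implicit Types (x y z : S) (b : E) (i j : I) (s : seq I).

Lemma as_norm_mono (a b : E) : (forall i, `|a i| <= `|b i|) -> `|a| <= `|b|.
Proof. by move=> ab; exact: (as_solid (asvalP b) ab).2. Qed.

Definition sum_nrm x : E := AsElt (sumvalP x).

Lemma sum_nrm_norm x : `|sum_nrm x| = `|x|. Proof. by []. Qed.

Lemma le_sum_norm x b : (forall i, `|x i| <= `|b i|) -> `|x| <= `|b|.
Proof.
by move=> xb; rewrite -sum_nrm_norm; apply: as_norm_mono => i; rewrite normr_id.
Qed.

Lemma sumvalD x y i : (x + y) i = x i + y i. Proof. by []. Qed.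
Lemma sumvalN x i : (- x) i = - x i. Proof. by []. Qed.
Lemma sumvalZ (k : R) x i : (k *: x) i = k *: x i. Proof. by []. Qed.
Lemma asvalD (a b : E) i : (a + b) i = a i + b i. Proof. by []. Qed.
Lemma asvalN (a : E) i : (- a) i = - a i. Proof. by []. Qed.
Lemma asvalZ (k : R) (a : E) i : (k *: a) i = k * a i. Proof. by []. Qed.

Lemma as_basisE i j : as_basis E i j = (`[< j = i >])%:R.
Proof.
by rewrite -[LHS]/(\1_[set i] j) indicE.
Qed.

(** The summands have different types, so the entry has to be transported along
    the equality of indices. *)
Definition sum_inj_fun i (t : X i) j : X j :=
  if pselect (i = j) is left e then eq_rect i (fun j => X j) t j e else 0.

Lemma sum_inj_fun_same i (t : X i) : sum_inj_fun t i = t.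
Proof.
rewrite /sum_inj_fun; case: pselect => // e.
by rewrite (Prop_irrelevance e erefl).
Qed.

Lemma sum_inj_fun_other i (t : X i) j : i <> j -> sum_inj_fun t j = 0.
Proof. by rewrite /sum_inj_fun; case: pselect. Qed.

Lemma sum_inj_subproof i (t : X i) : (fun j => `|sum_inj_fun t j|) \in ascarrier E.
Proof.
rewrite (_ : (fun j => _) = `|t| *: as_basis E i) ?asvalP//.
apply/funext => j; rewrite -[RHS]/(`|t| * as_basis E i j) as_basisE.
case: asboolP => [->|ji]; first by rewrite sum_inj_fun_same mulr1.
by rewrite sum_inj_fun_other ?normr0 ?mulr0// => /esym.
Qed.

Definition sum_inj i (t : X i) : S := AbsSum (sum_inj_subproof t).

Lemma sum_inj_norm i (t : X i) : `|sum_inj t| <= `|t|.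
Proof.
have -> : `|t| = `| `|t| *: as_basis E i|.
  by rewrite normrZ normr_id -[X in _ * X]/(asnorm E \1_[set i]) as_normalised mulr1.
apply: le_sum_norm => j; rewrite -[sum_inj t j]/(sum_inj_fun t j) asvalZ as_basisE.
case: asboolP => [->|ji]; first by rewrite sum_inj_fun_same mulr1 normr_id.
by rewrite sum_inj_fun_other ?normr0// => /esym.
Qed.

Lemma sum_inj_linear i : linear (@sum_inj i).
Proof.
move=> k t t'; apply: sumval_inj => j.
rewrite sumvalD sumvalZ -[LHS]/(sum_inj_fun _ j).
rewrite -[sum_inj t j]/(sum_inj_fun t j) -[sum_inj t' j]/(sum_inj_fun t' j).
case: (pselect (i = j)) => [e|ij]; first by subst j; rewrite !sum_inj_fun_same.
by rewrite !sum_inj_fun_other// scaler0 addr0.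
Qed.

HB.instance Definition _ i :=
  GRing.isLinear.Build R (X i) S _ (@sum_inj i) (@sum_inj_linear i).

Definition trunc_fun s x i : X i := if `[< List.In i s >] then x i else 0.

Lemma trunc_subproof s x : (fun i => `|trunc_fun s x i|) \in ascarrier E.
Proof.
apply: (as_solid (sumvalP x) _).1 => i; rewrite !normr_id /trunc_fun.
by case: asboolP; rewrite // normr0.
Qed.

Definition trunc s x : S := AbsSum (trunc_subproof s x).

Lemma trunc_nil x : trunc [::] x = 0.
Proof.
by apply: sumval_inj => i; rewrite -[LHS]/(trunc_fun _ _ _) /trunc_fun asboolF.
Qed.

(** Makes induction on the list of indices possible: a repeated index adds
    nothing, since truncation only depends on the set of entries of the list. *)
Lemma trunc_cons i s x : trunc (i :: s) x =
  trunc s x + (if `[< List.In i s >] then 0 else sum_inj (x i)).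
Proof.
apply: sumval_inj => j; rewrite sumvalD -[LHS]/(trunc_fun _ _ _).
rewrite -[trunc _ _ _]/(trunc_fun _ _ _) /trunc_fun.
case: (pselect (i = j)) => [e|ij].
  subst j; rewrite [`[< List.In i (i :: s) >]]asboolT; last by left.
  by case: asboolP => _; rewrite ?addr0// add0r -[RHS]/(sum_inj_fun _ i) sum_inj_fun_same.
have -> : (if `[< List.In i s >] then 0 else sum_inj (x i)) j = 0.
  by case: asboolP => // _; exact: sum_inj_fun_other.
rewrite addr0 (_ : `[< _ >] = `[< List.In j s >])//.
by apply/asboolP/asboolP => [[]|]//; right.
Qed.

Lemma basis_sum_notin s (c : I -> R) i : ~ List.In i s ->
  (\sum_(j <- s) c j *: as_basis E j) i = 0.
Proof.
elim: s => [|j s IH] /= si; first by rewrite big_nil.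
rewrite big_cons asvalD IH ?addr0; last by move=> ?; apply: si; right.
by rewrite asvalZ as_basisE asboolF ?mulr0// => ij; apply: si; left.
Qed.

(** If [b] in the span is supported in [s] and close to the norm sequence of [x],
    then off [s] the entries of [x] are those of the difference with [b], and on
    [s] the truncation is exact; so [trunc s x] is at least as close to [x]. *)
Lemma trunc_dense x (e : R) : dense (@basis_span R I E) -> 0 < e ->
  exists s, `|x - trunc s x| < e.
Proof.
move=> /(_ (ball (sum_nrm x) e)) dE e0.
have [| |b [xb [s [c bE]]]] := dE.
- by exists (sum_nrm x); exact: ballxx.
- exact: ball_open.
exists s; move: xb; rewrite -ball_normE /=; apply: le_lt_trans.
apply: le_sum_norm => i; rewrite sumvalD sumvalN asvalD asvalN.
rewrite -[trunc _ _ _]/(trunc_fun _ _ _) /trunc_fun.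
case: asboolP => [_|si]; first by rewrite subrr normr0.
by rewrite bE basis_sum_notin// !subr0 normr_id.
Qed.

End absSum_tools.

(** * Weighted embeddings of the sequence space *)

Section weighting.
Variables (R : realType) (I : Type) (E : absSpace R I).
Variable X : I -> completeNormedModType R.
Variables (M : R) (w : forall i, X i).
Hypothesis wM : forall i, `|w i| <= M.

Lemma weight_subproof (b : E) : (fun i => `|b i *: w i|) \in ascarrier E.
Proof.
apply: (as_solid (asvalP (M *: b)) _).1 => i.
rewrite normr_id -[X in _ <= `|X|]/(M * b i) normrZ normrM mulrC.
by apply: ler_wpM2r => //; rewrite (le_trans (wM i))// ler_norm.
Qed.

Definition weight (b : E) : absSum E X := AbsSum (weight_subproof b).

Lemma weight_linear : linear weight.
Proof.
move=> k b c; apply: sumval_inj => i; rewrite sumvalD sumvalZ.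
by rewrite -[LHS]/((k * b i + c i) *: w i) scalerDl -scalerA.
Qed.

HB.instance Definition _ :=
  GRing.isLinear.Build R E (absSum E X) _ weight weight_linear.

(** [M] may only be negative when the index type is empty, and then both spaces
    are trivial. *)
Lemma weight_norm b : `|weight b| <= M * `|b|.
Proof.
have [i|ni] := pselect (exists i : I, True); last first.
  have -> : weight b = 0 by apply: sumval_inj => i; case: ni; exists i.
  have -> : b = 0 by apply/val_inj/funext => i; case: ni; exists i.
  by rewrite !normr0 mulr0.
have M0 : 0 <= M by have [j _] := i; exact: le_trans (wM j).
rewrite -[X in X * _](ger0_norm M0) -normrZ; apply: le_sum_norm => j.
rewrite -[weight b j]/(b j *: w j) asvalZ normrZ normrM mulrC.
rewrite (ger0_norm M0); apply: ler_wpM2r; [exact: normr_ge0|exact: wM].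
Qed.

End weighting.

(** * Functionals on the sum and their modulus *)

Section functional.
Variables (R : realType) (I : Type) (E : absSpace R I).
Hypothesis hdense : dense (@basis_span R I E).
Variable X : I -> completeNormedModType R.
Local Notation S := (absSum E X).
Variable f : {linear S -> R}.
Hypothesis f1 : forall z, `|f z| <= `|z|.
Implicit Types (x y z : S) (b : E) (i j : I).

Definition coordf i : {linear X i -> R} := f \o @sum_inj R I E X i.

Lemma coordf_continuous i : continuous (coordf i : X i -> R).
Proof.
apply: (@bounded_continuous _ _ _ 1) => t; rewrite mul1r.
exact: le_trans (f1 _) (sum_inj_norm _ _).
Qed.

Lemma form_trunc_cons i s z : f (trunc (i :: s) z) =
  f (trunc s z) + if `[< List.In i s >] then 0 else coordf i (z i).
Proof. by rewrite trunc_cons linearD; case: ifP => // _; rewrite linear0. Qed.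

(** The value of [f] at a truncation is a finite sum of values of the [coordf i],
    and truncations are dense. *)
Lemma form_ge0 z : (forall i, 0 <= coordf i (z i)) -> 0 <= f z.
Proof.
move=> z0; have tz0 s : 0 <= f (trunc s z).
  elim: s => [|i s IH]; first by rewrite trunc_nil linear0.
  by rewrite form_trunc_cons addr_ge0//; case: ifP.
apply/ler_addgt0Pl => e e0; have [s zs] := trunc_dense z hdense e0.
rewrite (le_trans (tz0 s))// -lerBlDr -linearB.
by rewrite (le_trans (ler_norm _))// (le_trans (f1 _))// distrC ltW.
Qed.

Lemma form_le y z : (forall i, coordf i (y i) <= coordf i (z i)) -> f y <= f z.
Proof.
move=> yz; rewrite -subr_ge0 -linearB; apply: form_ge0 => i.
rewrite sumvalD sumvalN linearB subr_ge0; exact: yz.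
Qed.

(** A Fatou inequality: by nonnegativity, discarding all but finitely many
    coordinates only decreases [f (z_ n)], and on finitely many coordinates [f]
    passes to the limit. *)
Lemma form_fatou (z_ : nat -> S) z : (forall n i, 0 <= coordf i (z_ n i)) ->
    (forall i, coordf i (z_ n i) @[n --> \oo] --> coordf i (z i)) ->
  forall e, 0 < e -> \forall n \near \oo, f z - e < f (z_ n).
Proof.
move=> z0 zz e e0; have [s zs] := trunc_dense z hdense (divr_gt0 e0 (ltr0n R 2)).
have tz : f (trunc s (z_ n)) @[n --> \oo] --> f (trunc s z).
  elim: s {zs} => [|i s IH].
    rewrite trunc_nil linear0 (_ : (fun n => _) = fun=> 0); first exact: cvg_cst.
    by apply/funext => n; rewrite trunc_nil linear0.
  rewrite form_trunc_cons.
  rewrite (_ : (fun n => f _) = fun n => f (trunc s (z_ n)) +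
      if `[< List.In i s >] then 0 else coordf i (z_ n i)); last first.
    by apply/funext => n; rewrite form_trunc_cons.
  by apply: cvgD => //; case: ifP => _ //; exact: cvg_cst.
have e2 : f (trunc s z) - e / 2 < f (trunc s z) by rewrite gtrBl divr_gt0.
apply: filterS (cvgr_gt _ tz _ e2) => n fz.
have le1 : f (trunc s (z_ n)) <= f (z_ n).
  apply: form_le => i; rewrite -[trunc _ _ i]/(trunc_fun _ _ _) /trunc_fun.
  by case: asboolP => _ //; rewrite linear0; exact: z0.
have le2 : f z - f (trunc s z) < e / 2.
  by rewrite -linearB (le_lt_trans (ler_norm _))// (le_lt_trans (f1 _)).
lra.
Qed.

(** The functional [g] maps [b] to the sum of the [b i * dual_norm (coordf i)].
    Taking [L b] to be [b] weighted by vectors [v i] with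
    [coordf i (v i) = dual_norm (coordf i)] defines it as [f \o L]; but such
    [v i] only exist with norms up to a constant larger than 1, which gives a
    bound for [g] that is too weak.  The sharp bound comes from comparing
    [c *: L b], for [c < 1], with the weighting of the absolute value of [b] by
    vectors [u i] in the unit ball with [coordf i (u i)] equal to [c] times the
    dual norm. *)
Lemma form_modulus : exists (g : {linear E -> R}) (L : E -> S),
  [/\ forall b, `|g b| <= `|b|, forall b, g b = f (L b) &
      forall b i, coordf i (L b i) = b i * dual_norm (coordf i)].
Proof.
have approx (c : R) : 0 <= c < 1 -> exists w : forall i, X i,
    (forall i, `|w i| <= 1) /\ forall i, coordf i (w i) = c * dual_norm (coordf i).
  move=> c01; pose w i := cid (dual_norm_approx (coordf_continuous (i := i)) c01).
  by exists (fun i => projT1 (w i)); split=> i; case: (projT2 (w i)).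
have [|w [w1 wE]] := approx 2^-1.
  by rewrite invr_ge0 invf_lt1 ?ler0n ?ltr1n ?ltr0n.
pose v i := 2 *: w i.
have v2 i : `|v i| <= 2 by rewrite normrZ ger0_norm// ler_piMr ?w1.
have LE b i : coordf i (weight v2 b i) = b i * dual_norm (coordf i).
  by rewrite -[weight v2 b i]/(b i *: (2 *: w i)) !linear_formZ wE; field.
exists (f \o weight v2), (weight v2); split=> //.
have gb b : f (weight v2 b) <= `|b|.
  have [//|bg] := leP (f (weight v2 b)) `|b|; set g := f _ in bg *.
  have g0 : 0 < g := le_lt_trans (normr_ge0 b) bg.
  (* [c * g] is the midpoint of [`|b|] and [g] *)
  pose c := (`|b| + g) / (2 * g).
  have c01 : 0 <= c < 1.
    rewrite divr_ge0 ?addr_ge0 ?mulr_ge0 ?(ltW g0)//=.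
    by rewrite ltr_pdivrMr ?mulr_gt0//; lra.
  have [u [u1 uE]] := approx c c01.
  have [bE bb] : (fun i => `|b i|) \in ascarrier E /\
      asnorm E b = asnorm E (fun i => `|b i|).
    by apply: as_absolute (asvalP b) _ => i; rewrite normr_id.
  have {}bb : `|b| = `|AsElt bE| := bb.
  have : f (c *: weight v2 b) <= f (weight u1 (AsElt bE)).
    apply: form_le => i; rewrite sumvalZ linear_formZ LE.
    rewrite -[weight _ _ i]/(`|b i| *: u i) linear_formZ uE mulrCA.
    apply: ler_wpM2r; last exact: ler_norm.
    by apply: mulr_ge0; [case/andP: c01|exact/dual_norm_ge0/coordf_continuous].
  rewrite linear_formZ -/g => cg.
  have := le_trans (le_trans (ler_norm _) (f1 _)) (weight_norm u1 (AsElt bE)).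
  rewrite -bb mul1r => /(le_trans cg).
  have -> : c * g = (`|b| + g) / 2 by rewrite /c; field; rewrite gt_eqF.
  lra.
move=> b; rewrite /= ler_norml gb andbT lerNl -linearN /= -linearN.
by rewrite (le_trans (gb _))// normrN.
Qed.

Lemma form_coord_le z i : coordf i (z i) <= dual_norm (coordf i) * `|z i|.
Proof.
exact: le_trans (ler_norm _) (le_dual_norm (coordf_continuous (i := i)) _).
Qed.

(** Replacing the [i]-th entry of [z] by [L (sum_nrm z) i], where [coordf i] equals
    its bound [dual_norm (coordf i) * `|z i|], raises [f] by the left-hand side,
    and by monotonicity the result is still at most [g (sum_nrm z)]. *)
Lemma form_defect (g : {linear E -> R}) (L : E -> S) z i :
    (forall b, g b = f (L b)) ->
    (forall b j, coordf j (L b j) = b j * dual_norm (coordf j)) ->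
  dual_norm (coordf i) * `|z i| - coordf i (z i) <= g (sum_nrm z) - f z.
Proof.
move=> gL LE; set b := sum_nrm z.
have bE j : b j = `|z j| by [].
suff : f (z + sum_inj E (L b i - z i)) <= f (L b).
  by rewrite linearD gL -[f (sum_inj _ _)]/(coordf i _) linearB LE bE mulrC; lra.
apply: form_le => j; rewrite sumvalD -[sum_inj _ _ j]/(sum_inj_fun _ j).
have [e|ij] := pselect (i = j); first by subst j; rewrite sum_inj_fun_same addrC subrK.
by rewrite sum_inj_fun_other// addr0 LE bE mulrC form_coord_le.
Qed.

End functional.

(** * Convergence of the coordinates *)

Section sphere_sequences.
Variables (R : realType) (V : normedModType R).

Lemma norm_sum_shift_cvg (x : V) (u : nat -> V) : unit_sphere x ->
    (forall n, unit_sphere (u n)) -> `|u n + x| @[n --> \oo] --> (2 : R) ->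
  `|u n + x + 2 *: x| @[n --> \oo] --> (4 : R).
Proof.
move=> x1 u1 ux.
apply: (@squeeze_cvgr _ _ _ _ (fun n => 3 * `|u n + x| - 2) (fun=> 4)); last exact: cvg_cst.
  apply: nearW => n; apply/andP; split; last first.
    have := ler_normD (u n + x) (2 *: x); have := ler_normD (u n) x.
    by rewrite normrZ (u1 n) x1 ger0_norm//; lra.
  (* three copies of [u n + x] exceed [u n + 3 x] by two copies of [u n] *)
  have -> : 3 * `|u n + x| = `|(u n + x + 2 *: x) + 2 *: u n|.
    rewrite -[X in X * _](@ger0_norm R 3)// -normrZ; congr `|_|.
    rewrite (_ : (3 : R) = 1 + 2); last by lra.
    by rewrite scalerDl scale1r scalerDr [2 *: u n + _]addrC addrA.
  have := ler_normD (u n + x + 2 *: x) (2 *: u n).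
  by rewrite [`|2 *: u n|]normrZ (u1 n) ger0_norm//; lra.
rewrite (_ : (4 : R) = 3 * 2 - 2); last by lra.
by apply: cvgB; [exact: cvgMr|exact: cvg_cst].
Qed.

End sphere_sequences.

Section coordinates.
Variables (R : realType) (I : Type) (E : absSpace R I).
Variable X : I -> completeNormedModType R.
Variables (x : absSum E X) (u : nat -> absSum E X).
Hypothesis hP : propertyP E.
Hypothesis x1 : unit_sphere x.
Hypothesis u1 : forall n, unit_sphere (u n).
Hypothesis ux : `|u n + x| @[n --> \oo] --> (2 : R).

Lemma sum_nrm_sum_cvg : `|sum_nrm (u n) + sum_nrm x| @[n --> \oo] --> (2 : R).
Proof.
apply: (@squeeze_cvgr _ _ _ _ (fun n => `|u n + x|) (fun=> 2)) => //; last exact: cvg_cst.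
apply: nearW => n; apply/andP; split.
  apply: le_sum_norm => i; rewrite asvalD sumvalD.
  by rewrite (le_trans (ler_normD _ _))// ler_norm.
rewrite (le_trans (ler_normD _ _))// !sum_nrm_norm (u1 n) x1.
by rewrite (_ : (2 : R) = 1 + 1)//; lra.
Qed.

Lemma coord_norm_cvg i : `|u n i| @[n --> \oo] --> `|x i|.
Proof.
exact: (@hP (fun n => sum_nrm (u n)) (sum_nrm x) u1 x1 sum_nrm_sum_cvg i).
Qed.

(** Property (P) for the norm sequences of [u n + x] and twice that of [x]: their
    sum dominates [u n + 3 x], whose norm tends to 4. *)
Lemma coord_norm_sum_cvg i : `|u n i + x i| @[n --> \oo] --> 2 * `|x i|.
Proof.
have n2 : `|2 *: sum_nrm x| = 2 by rewrite normrZ sum_nrm_norm x1 mulr1 ger0_norm.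
apply: (propertyP_homogeneous (u := fun n => sum_nrm (u n + x))
  (a := 2 *: sum_nrm x)) => //; rewrite ?n2//; last first.
  by rewrite -normr_eq0 n2.
have -> : 2 * 2 = 4 :> R by lra.
apply: (@squeeze_cvgr _ _ _ _ (fun n => `|u n + x + 2 *: x|) (fun n => `|u n + x| + 2)).
- apply: nearW => n; apply/andP; split.
    apply: le_sum_norm => j; rewrite asvalD asvalZ sumvalD sumvalZ.
    by rewrite (le_trans (ler_normD _ _))// normrZ (@ger0_norm _ 2)// ler_norm.
  by rewrite (le_trans (ler_normD _ _))// n2.
- exact: norm_sum_shift_cvg.
- rewrite (_ : (4 : R) = 2 + 2); last by lra.
  by apply: cvgD => //; exact: cvg_cst.
Qed.

End coordinates.

(** * The theorem *)

Theorem proposition3p7 (R : realType) (I : Type) (hI : inhabited I)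
    (E : absSpace R I) (hdense : dense (@basis_span R I E))
    (X : I -> completeNormedModType R)
    (hX : forall i, luacs_plus (X i))
    (hE : luacs_plus E) (hP : propertyP E) :
  luacs_plus (absSum E X).
Proof.
move=> x u x1 u1 ux f [fc fn].
have f1 z : `|f z| <= `|z| by rewrite -[leRHS]mul1r -fn le_dual_norm.
have [g [L [g1 gL LE]]] := form_modulus hdense f1.
pose a := sum_nrm x; pose a_ n := sum_nrm (u n).
have defect z i := form_defect hdense f1 z i gL LE.
have coord0 (z : absSum E X) i : 0 <= dual_norm (coordf f i) * `|z i| - coordf f i (z i).
  by rewrite subr_ge0; exact: (form_coord_le f1).
have f_le_g (z : absSum E X) : f z <= g (sum_nrm z).
  rewrite gL; apply: (form_le hdense f1) => i.
  by rewrite LE mulrC; exact: (form_coord_le f1).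
have ga_le1 (z : absSum E X) : unit_sphere z -> g (sum_nrm z) <= 1.
  by move=> z1; rewrite (le_trans (ler_norm _))// (le_trans (g1 _))// sum_nrm_norm z1.
have coordP i := luacs_plus_homogeneous (hX i)
  (coord_norm_cvg hP x1 u1 ux (i := i)) (coord_norm_sum_cvg hP x1 u1 ux (i := i))
  (coordf_continuous f1 (i := i)).
have f_u n : f (u n) <= 1 := le_trans (f_le_g _) (ga_le1 _ (u1 n)).
split=> [fu|fx].
- have gu : g (a_ n) @[n --> \oo] --> (1 : R).
    apply: (@squeeze_cvgr _ _ _ _ (fun n => f (u n)) (fun=> 1)) => //; last exact: cvg_cst.
    by apply: nearW => n; rewrite f_le_g ga_le1.
  have gd : dual_unit_sphere g.
    have gc : continuous (g : E -> R).
      by apply: (@bounded_continuous _ _ _ 1) => b; rewrite mul1r.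
    split=> //; apply/eqP; rewrite eq_le dual_norm_le ?ler01//=; last first.
      by move=> b; rewrite mul1r.
    apply: (cvgr_to_le gu); apply: nearW => n.
    rewrite (le_trans (ler_norm _))// (le_trans (le_dual_norm gc _))//.
    by rewrite sum_nrm_norm (u1 n) mulr1.
  have ga : g a = 1 := (hE a a_ x1 u1 (sum_nrm_sum_cvg x1 u1 ux) g gd).1 gu.
  apply/eqP; rewrite eq_le; apply/andP; split.
    by rewrite -ga f_le_g.
  rewrite -ga gL; apply: (form_le hdense f1) => i; rewrite LE mulrC.
  suff -> : coordf f i (x i) = dual_norm (coordf f i) * `|x i| by [].
  apply/coordP.
  apply: (@squeeze_cvgr _ _ _ _ (fun=> 0) (fun n => g (a_ n) - f (u n))).
  + by apply: nearW => n; rewrite coord0 defect.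
  + exact: cvg_cst.
  + by rewrite -(subrr 1); apply: cvgB.
- have xE i : coordf f i (x i) = dual_norm (coordf f i) * `|x i|.
    apply/esym/eqP; rewrite -subr_eq0 eq_le coord0 andbT.
    by rewrite (le_trans (defect x i))// fx subr_le0 ga_le1.
  have ga : g a = 1.
    by apply/eqP; rewrite eq_le ga_le1// -[X in X <= _]fx f_le_g.
  have fu i : coordf f i (u n i) @[n --> \oo] --> coordf f i (x i).
    have := (coordP i).2 (xE i).
    have gu : dual_norm (coordf f i) * `|u n i| @[n --> \oo] -->
        dual_norm (coordf f i) * `|x i|.
      by apply: cvgMr; exact: (coord_norm_cvg hP x1 u1 ux (i := i)).
    move=> /(cvgB gu); rewrite subr0 -xE; apply: cvg_trans.
    by apply: near_eq_cvg; apply: nearW => n /=; rewrite opprB addrC subrK.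
  (* these entries are nonnegative, as the Fatou inequality requires *)
  have zE (z : absSum E X) i : coordf f i ((z + L (sum_nrm z)) i) =
      coordf f i (z i) + dual_norm (coordf f i) * `|z i|.
    by rewrite sumvalD linearD LE; congr (_ + _); exact: mulrC.
  apply/cvgrPdist_lt => e e0.
  have := form_fatou hdense f1 (z_ := (fun n => u n + L (a_ n))) (z := x + L a) _ _ e0.
  rewrite linearD fx -gL ga => fat.
  apply: filterS (fat _ _) => [n|n i|i].
  + rewrite linearD -gL => fun1.
    have : g (a_ n) <= 1 := ga_le1 _ (u1 n).
    by rewrite ger0_norm ?subr_ge0//; lra.
  + rewrite zE addrC -[coordf f i _]opprK subr_ge0 -linearN -normrN.
    exact: (form_coord_le f1 (- u n)).
  + rewrite zE; under eq_cvg do rewrite zE.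
    by apply: cvgD => //; apply: cvgMr; exact: (coord_norm_cvg hP x1 u1 ux (i := i)).
Qed.
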